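(* Let $(\Gamma,S)$ be a marked group, let $X$ be a standard Borel space, and let $a:\Gamma\curvearrowright X$ be a free Borel action whose Borel asymptotic separation index is $1$. Suppose that no element of $S$ has odd order. Then $\chi_B'(G(a,S))\le |S|+1$.
   Context: A marked group $(\Gamma,S)$ is a group $\Gamma$ together with a finite symmetric generating set $S$ not containing the identity. For a free Borel action $a:\Gamma\curvearrowright X$, the Schreier graph $G(a,S)$ is the graph on $X$ in which $x\neq y$ are adjacent iff $\gamma\cdot_a x=y$ for some $\gamma\in S$. An edge coloring of a graph is a map from its edges to a set of colors giving distinct colors to edges sharing a vertex; $\chi_B'(G)$ is the least cardinality of a color set for which a Borel edge coloring of $G$ exists. For a graph $G$ and positive integer $N$, $G^{\le N}$ is the graph joining two vertices iff there is a $G$-path of length at most $N$ between them. For a locally finite Borel graph $G$ on $X$, the Borel asymptotic separation index $\mathrm{asi}_B(G)$ is the least $s\in\omega$ such that for every positive integer $N$ there is a partition of $X$ into Borel sets $U_0,\dots,U_s$ such that each induced graph $G^{\le N}\upharpoonright U_i$ has only finite connected components. The Borel asymptotic separation index of the action $a$ is $\mathrm{asi}_B(G(a,S))$ (this does not depend on the choice of finite generating set). *)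

(* Defs.v *)
From HB Require Import structures.
From mathcomp Require Import all_boot all_order all_algebra.
From mathcomp Require Import all_classical all_reals all_analysis.
From mathcomp Require Import Rstruct Rstruct_topology.
From Stdlib Require Import Relations.

Set Implicit Arguments.
Unset Strict Implicit.
Unset Printing Implicit Defensive.

Import Order.TTheory GRing.Theory Num.Theory.
Import numFieldNormedType.Exports.
Local Open Scope classical_set_scope.

Definition is_group (G : Type) (mul : G -> G -> G) (one : G) (inv : G -> G) : Prop :=
  [/\ forall a b c, mul a (mul b c) = mul (mul a b) c,
      forall a, mul one a = a,
      forall a, mul a one = a,
      forall a, mul (inv a) a = one &
      forall a, mul a (inv a) = one].

Definition gpow (G : Type) (mul : G -> G -> G) (one : G) (g : G) (n : nat) : G :=
  iter n (mul g) one.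

Definition has_order (G : Type) (mul : G -> G -> G) (one : G) (g : G) (n : nat) : Prop :=
  [/\ (0 < n)%N, gpow mul one g n = one &
      forall m, (0 < m)%N -> (m < n)%N -> gpow mul one g m <> one].

Definition marked_group (G : eqType) (mul : G -> G -> G) (one : G) (inv : G -> G)
    (S : seq G) : Prop :=
  [/\ is_group mul one inv,
      uniq S,
      one \notin S,
      (forall s, s \in S -> inv s \in S) &
      (forall g : G, exists l : seq G, all (fun s => s \in S) l /\ foldr mul one l = g)].

(* A Polish space: a complete (pseudo)metric space which is Hausdorff
   (so the pseudometric is a metric) and separable. *)
Definition separable_space (T : topologicalType) : Prop :=
  exists D : set T, countable D /\ dense D.

Definition polish_space (P : completePseudoMetricType Rdefinitions.R) : Prop :=
  hausdorff_space P /\ separable_space P.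

Definition standard_borel (d : measure_display) (X : measurableType d) : Prop :=
  exists (P : completePseudoMetricType Rdefinitions.R) (f : X -> P),
    polish_space P /\ bijective f /\
    forall A : set X, measurable A <-> <<s [set U : set P | open U] >> (f @` A).

Definition free_borel_action (G : Type) (mul : G -> G -> G) (one : G)
    (d : measure_display) (X : measurableType d) (act : G -> X -> X) : Prop :=
  [/\ forall x, act one x = x,
      forall g h x, act (mul g h) x = act g (act h x),
      forall g, measurable_fun setT (act g) &
      forall g x, act g x = x -> g = one].

Definition schreier_graph (G : eqType) (X : Type) (act : G -> X -> X) (S : seq G)
    : X -> X -> Prop :=
  fun x y => x <> y /\ exists2 s, s \in S & act s x = y.

Definition borel_edge_coloring (d : measure_display) (X : measurableType d)
    (E : X -> X -> Prop) (k : nat) (c : X * X -> 'I_k) : Prop :=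
  [/\ forall x y, E x y -> c (x, y) = c (y, x),
      forall x y z, E x y -> E x z -> y <> z -> c (x, y) <> c (x, z) &
      forall i : 'I_k, measurable [set p : X * X | E p.1 p.2 /\ c p = i]].

Fixpoint walk (X : Type) (E : X -> X -> Prop) (n : nat) (x y : X) : Prop :=
  match n with
  | 0 => x = y
  | n'.+1 => exists z, E x z /\ walk E n' z y
  end.

Definition graph_pow_le (X : Type) (E : X -> X -> Prop) (N : nat) : X -> X -> Prop :=
  fun x y => x <> y /\ exists n, (n <= N)%N /\ walk E n x y.

Definition induced_component (X : Type) (F : X -> X -> Prop) (U : set X) (x : X)
    : set X :=
  [set y | clos_refl_trans X (fun u v => U u /\ U v /\ F u v) x y].

Definition asi_le (d : measure_display) (X : measurableType d)
    (E : X -> X -> Prop) (s : nat) : Prop :=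
  forall N : nat, (0 < N)%N ->
    exists U : 'I_s.+1 -> set X,
      [/\ forall i, measurable (U i),
          forall x, exists i, U i x,
          forall i j x, U i x -> U j x -> i = j &
          forall i x, U i x -> finite_set (induced_component (graph_pow_le E N) (U i) x)].

Definition asiB_eq (d : measure_display) (X : measurableType d)
    (E : X -> X -> Prop) (s : nat) : Prop :=
  asi_le E s /\ forall t, (t < s)%N -> ~ asi_le E t.

(* Main.v *)
(* For s in S of infinite order, each s-line can be 2-edge-coloured in a Borel
   way once a Borel set of its edges, recurrent along the line, is set aside:
   alternate along the line, restarting after each such edge.  All the edges set
   aside, for all generators, get one extra colour, so they must form a matching.
   With N large and U_0, U_1 as in the definition of asi = 1, let B_r be the set
   of points at distance at most r from U_0; generator number i sets aside the
   edges (x, s x) that leave B_{2i}.  Those of different generators lie in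
   disjoint spheres around U_0.  They are recurrent because B_{2i} and U_1 have
   only finite components, so no half-line stays in B_{2i}, nor outside it.
   The cycles of a generator of even order need no extra colour: a Borel
   transversal of the cycles gives a place to start.  The alternating colours of
   {s, s^-1} are the indices of s and s^-1 in S; an involution uses its own. *)
Require Import Defs.
From HB Require Import structures.
From mathcomp Require Import all_boot all_order all_algebra.
From mathcomp Require Import all_classical all_reals all_analysis.
From mathcomp Require Import Rstruct.
From Stdlib Require Import Relations.

Set Implicit Arguments.
Unset Strict Implicit.
Unset Printing Implicit Defensive.

Import Order.TTheory GRing.Theory Num.Theory.
Local Open Scope classical_set_scope.

(** * Countable separating families and Borel equality *)

Definition separating (T : Type) (A : nat -> set T) : Prop :=
  forall x y, x <> y -> exists n, A n x /\ ~ A n y.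

(** Balls of radius $1/(m+1)$ around the points of a countable dense set suffice: once $2/(m+1)$ is
    below a radius keeping [y] away from [x], such a ball centered close to [x] contains [x] and
    misses [y]. *)
Lemma polish_separating (P : completePseudoMetricType Rdefinitions.R) :
  polish_space P ->
  exists A : nat -> set P, (forall n, open (A n)) /\ separating A.
Proof.
case; rewrite ball_hausdorff => hP [D [/countable_injP[f finj] Ddense]].
(* A natural number codes a center, through the injection [f] on [D], and a radius; the union has at
   most one term. *)
pose O (km : nat * nat) : set P :=
  \bigcup_(q in [set q | D q /\ f q = km.1]) (ball q (km.2.+1%:R^-1)%R)°.
exists (fun n => if unpickle n is Some km then O km else set0); split.
  move=> n; case: unpickle => [km|]; last exact: open0.
  by apply: bigcup_open => q _; exact: open_interior.
move=> x y /eqP/hP[[r1 r2]] /= /eqP rxy.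
have yNx : ~ ball x r1%:num y.
  move=> xy; have : (ball x r1%:num `&` ball y r2%:num) y by split => //; exact: ballxx.
  by rewrite rxy.
have [m mr] : exists m, (m.+1%:R^-1 + m.+1%:R^-1 < r1%:num)%R.
  have r20 : (0 < r1%:num / 2)%R by apply: divr_gt0.
  have := near_infty_natSinv_lt (PosNum r20) => -[m _ /(_ m (leqnn m))] /= h.
  by exists m; rewrite (splitr (r1%:num)%R); apply: ltrD.
have m0 : (0 < m.+1%:R^-1 :> Rdefinitions.R)%R by rewrite invr_gt0.
have e0 : (0 < m.+1%:R^-1 / 2 :> Rdefinitions.R)%R by apply: divr_gt0.
have [q [qx Dq]] : (ball x (m.+1%:R^-1 / 2 : Rdefinitions.R)%R)° `&` D !=set0.
  apply: Ddense; last exact: open_interior.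
  by exists x; apply: nbhsx_ballx.
exists (pickle (f q, m)); rewrite pickleK; split.
  exists q => //; apply/nbhs_ballP; exists (m.+1%:R^-1 / 2)%R => //= z xz.
  rewrite (splitr (m.+1%:R^-1)%R); apply: ball_triangle xz.
  by apply: ball_sym; exact: interior_subset qx.
move=> -[q' [Dq' /= fq'] /interior_subset q'y].
have eqq : q' = q by apply: finj; rewrite ?inE.
rewrite eqq in q'y; apply: yNx; apply: (le_ball (ltW mr)).
apply: ball_triangle q'y; apply: le_ball (interior_subset qx).
by rewrite [leRHS]splitr lerDl ltW.
Qed.

Lemma standard_borel_separating (d : measure_display) (X : measurableType d) :
  standard_borel X ->
  exists A : nat -> set X, (forall n, measurable (A n)) /\ separating A.
Proof.
move=> [P [f [/polish_separating[A [oA sepA]] [[g fK gK] fm]]]].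
exists (fun n => f @^-1` A n); split=> [n|x y xy].
  apply/fm; rewrite (_ : f @` _ = A n); first by apply: sub_sigma_algebra; exact: oA.
  rewrite eqEsubset; split => [_ [x Ax <-]//|y Ay].
  by exists (g y); rewrite /preimage/= ?gK.
by apply: sepA => /(can_inj fK).
Qed.

Lemma measurable_iff (d : measure_display) (T : measurableType d) (P Q : T -> Prop) :
  measurable [set x | P x] -> measurable [set x | Q x] ->
  measurable [set x | P x <-> Q x].
Proof.
move=> mP mQ.
rewrite (_ : [set x | _] = ([set x | P x] `&` [set x | Q x]) `|`
                           (~` [set x | P x] `&` ~` [set x | Q x])).
  by apply: measurableU; apply: measurableI => //; exact: measurableC.
rewrite eqEsubset; split=> x /=; last tauto.
by case: (pselect (P x)); tauto.
Qed.

(** Two points coincide iff they lie in the same sets [A n], which is a countable intersection of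
    Borel conditions. This makes the graph of each generator Borel in [X * X]. *)
Lemma measurable_eq_fun (d d' : measure_display) (T : measurableType d)
    (X : measurableType d') (A : nat -> set X) (u v : T -> X) :
  (forall n, measurable (A n)) -> separating A ->
  measurable_fun setT u -> measurable_fun setT v ->
  measurable [set t | u t = v t].
Proof.
move=> mA sepA mu mv.
rewrite (_ : [set t | _] = \bigcap_n [set t | A n (u t) <-> A n (v t)]).
  apply: bigcap_measurable; first by exists 0%N.
  move=> n _; apply: measurable_iff.
    by have := mu measurableT _ (mA n); rewrite setTI.
  by have := mv measurableT _ (mA n); rewrite setTI.
rewrite eqEsubset; split=> t /= => [uv n _|h]; first by rewrite /= uv.
apply: contrapT => /sepA[n [Au]]; apply.
by case: (h n I) => + _; apply.
Qed.

(** * A Borel linear order *)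

(** The lexicographic order on the sequences of memberships in the [A n], membership coming first.
    It serves to select one point from each finite cycle. *)
Definition lex_lt (X : Type) (A : nat -> set X) (x y : X) : Prop :=
  exists n, [/\ forall m, (m < n)%N -> (A m x <-> A m y), A n x & ~ A n y].

Lemma lex_lt_irr (X : Type) (A : nat -> set X) x : ~ lex_lt A x x.
Proof. by case=> n []. Qed.

Lemma lex_lt_trans (X : Type) (A : nat -> set X) x y z :
  lex_lt A x y -> lex_lt A y z -> lex_lt A x z.
Proof.
move=> [n [n1 n2 n3]] [m [m1 m2 m3]].
have [nm|mn|nm] := ltngtP n m.
- exists n; split => //; last by rewrite -(m1 n nm).
  by move=> k kn; rewrite n1// m1// (ltn_trans kn).
- exists m; split => //; last by rewrite n1.
  by move=> k km; rewrite n1 ?m1// (ltn_trans km).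
- by move: n3; rewrite nm.
Qed.

Lemma lex_lt_total (X : Type) (A : nat -> set X) x y :
  separating A -> x <> y -> lex_lt A x y \/ lex_lt A y x.
Proof.
move=> sepA /sepA[n0 [Ax Ay]].
have ex : exists n, `[< ~ (A n x <-> A n y) >] by exists n0; apply/asboolP; tauto.
case: (ex_minnP ex) => n /asboolP hn mn.
have ln m : (m < n)%N -> (A m x <-> A m y).
  by move=> h; apply: contrapT => /asboolP/mn; rewrite leqNgt h.
case: (pselect (A n x)) => Anx.
  by left; exists n; split => //; tauto.
right; exists n; split => //; last by tauto.
by move=> m /ln; tauto.
Qed.

Lemma measurable_lex_lt (d : measure_display) (X : measurableType d)
    (A : nat -> set X) (u v : X -> X) :
  (forall n, measurable (A n)) ->
  measurable_fun setT u -> measurable_fun setT v ->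
  measurable [set x | lex_lt A (u x) (v x)].
Proof.
move=> mA mu mv.
have mU n : measurable [set x | A n (u x)].
  by have := mu measurableT _ (mA n); rewrite setTI.
have mV n : measurable [set x | A n (v x)].
  by have := mv measurableT _ (mA n); rewrite setTI.
rewrite (_ : [set x | _] = \bigcup_n
  ((\bigcap_(m in [set m | (m < n)%N]) [set x | A m (u x) <-> A m (v x)]) `&`
   ([set x | A n (u x)] `&` ~` [set x | A n (v x)]))).
  apply: bigcupT_measurable => n; apply: measurableI; last first.
    by apply: measurableI => //; exact: measurableC.
  rewrite bigcap_mkcond; apply: bigcapT_measurable => m.
  by case: ifP => // _; exact: measurable_iff.
rewrite eqEsubset; split=> x /=.
  by move=> [n [h1 h2 h3]]; exists n.
by move=> [n _ [h1 [h2 h3]]]; exists n.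
Qed.

Lemma lex_lt_min (X : Type) (A : nat -> set X) (a : nat -> X) (n : nat) :
  separating A ->
  (forall i j, (i < n.+1)%N -> (j < n.+1)%N -> a i = a j -> i = j) ->
  exists2 i, (i < n.+1)%N &
    forall j, (j < n.+1)%N -> j <> i -> lex_lt A (a i) (a j).
Proof.
move=> sepA; elim: n => [|n IH] ainj.
  by exists 0%N => // -[].
have [i j hi hj|i ilt imin] := IH.
  by apply: ainj; rewrite ltnS ltnW.
have ne : a i <> a n.+1.
  move=> /ainj-/(_ (ltnW ilt) (ltnSn _)) h.
  by move: ilt; rewrite h ltnn.
case: (lex_lt_total sepA ne) => h; [exists i|exists n.+1] => //.
- exact: ltnW.
- move=> j; rewrite ltnS leq_eqVlt => /predU1P[-> //|jn ji].
  exact: imin.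
- move=> j; rewrite ltnS leq_eqVlt => /predU1P[-> //|jn _].
  have [->//|/eqP ji] := eqVneq j i.
  exact: lex_lt_trans h (imin _ jn ji).
Qed.

(** * First hitting times and their parity *)

Definition first_hit (X : Type) (h : X -> X) (T : set X) (n : nat) (x : X) : Prop :=
  T (iter n h x) /\ forall m, (m < n)%N -> ~ T (iter m h x).

Lemma first_hit_uniq (X : Type) (h : X -> X) (T : set X) m n x :
  first_hit h T m x -> first_hit h T n x -> m = n.
Proof.
move=> [m1 m2] [n1 n2]; case: (ltngtP m n) => // [mn|nm].
  by case: (n2 m mn).
by case: (m2 n nm).
Qed.

Lemma first_hit_ex (X : Type) (h : X -> X) (T : set X) n x :
  T (iter n h x) -> exists m, first_hit h T m x.
Proof.
move=> Tn; have ex : exists n, `[< T (iter n h x) >] by exists n; apply/asboolP.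
case: (ex_minnP ex) => m /asboolP hm mn; exists m; split=> // k km /asboolP/mn.
by rewrite leqNgt km.
Qed.

Lemma first_hitS (X : Type) (h : X -> X) (T : set X) n x :
  ~ T x -> first_hit h T n (h x) -> first_hit h T n.+1 x.
Proof.
move=> Tx [h1 h2]; split; first by rewrite iterSr.
by case=> [//|m]; rewrite ltnS iterSr; exact: h2.
Qed.

(** The value is [false] when the orbit never meets [T], so the level sets are Borel without any
    recurrence assumption. *)
Definition hit_parity (X : Type) (h : X -> X) (T : set X) (x : X) : bool :=
  `[< exists2 n, odd n & first_hit h T n x >].

Lemma hit_parityE (X : Type) (h : X -> X) (T : set X) n x :
  first_hit h T n x -> hit_parity h T x = odd n.
Proof.
move=> hn; apply/asboolP/idP => [[m om hm]|on]; last by exists n.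
by rewrite (first_hit_uniq hn hm).
Qed.

(** Outside [T], one application of [h] shortens the first hitting time by exactly one. *)
Lemma hit_parityN (X : Type) (h : X -> X) (T : set X) n x :
  T (iter n h (h x)) -> ~ T x -> hit_parity h T x = ~~ hit_parity h T (h x).
Proof.
move=> Tn Tx; have [m hm] := @first_hit_ex _ h T n _ Tn.
by rewrite (hit_parityE hm) (hit_parityE (first_hitS Tx hm)).
Qed.

Lemma measurable_fun_iter (d : measure_display) (X : measurableType d) (h : X -> X) n :
  measurable_fun setT h -> measurable_fun setT (iter n h).
Proof.
by move=> mh; elim: n => [|n IH]; [exact: measurable_id|exact: measurableT_comp].
Qed.

Lemma measurable_hit_parity (d : measure_display) (X : measurableType d)
    (h : X -> X) (T : set X) (b : bool) :
  measurable_fun setT h -> measurable T ->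
  measurable [set x | hit_parity h T x = b].
Proof.
move=> mh mT.
have mi n : measurable [set x | T (iter n h x)].
  by have := measurable_fun_iter n mh measurableT mT; rewrite setTI.
have mt : measurable [set x | hit_parity h T x].
  rewrite (_ : [set x | _] = \bigcup_(n in [set n | odd n]) ([set x | T (iter n h x)] `&`
     \bigcap_(m in [set m | (m < n)%N]) ~` [set x | T (iter m h x)])).
    apply: bigcup_measurable => n _; apply: measurableI => //.
    rewrite bigcap_mkcond; apply: bigcapT_measurable => m.
    by case: ifP => // _; exact: measurableC.
  rewrite eqEsubset; split=> x /=.
    by move=> /asboolP[n on [h1 h2]]; exists n.
  by move=> [n on [h1 h2]]; apply/asboolP; exists n.
case: b => //; rewrite (_ : [set x | _] = ~` [set x | hit_parity h T x]).
  exact: measurableC.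
by rewrite eqEsubset; split=> x /=; case: hit_parity.
Qed.

(** * Free actions and alternation along the orbits of one generator *)

Section GroupAction.
Variables (G : eqType) (mul : G -> G -> G) (one : G) (inv : G -> G).
Hypothesis grp : is_group mul one inv.

Lemma invgK g : inv (inv g) = g.
Proof.
have [mA m1 m2 mi im] := grp.
by rewrite -[LHS]m2 -(mi g) mA mi m1.
Qed.

Lemma gpowD g m n : gpow mul one g (m + n) = mul (gpow mul one g m) (gpow mul one g n).
Proof.
have [mA m1 _ _ _] := grp.
by elim: m => [|m IH]; rewrite ?add0n ?m1// addSn /= /gpow /= -mA -IH.
Qed.

Lemma has_order_ex g n :
  (0 < n)%N -> gpow mul one g n = one -> exists m, has_order mul one g m.
Proof.
move=> n0 gn.
have ex : exists n, (0 < n)%N && (gpow mul one g n == one) by exists n; rewrite n0 gn /=.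
case: (ex_minnP ex) => m /andP[m0 /eqP gm] mn; exists m; split => // k k0 km /eqP gk.
by have := mn k; rewrite k0 gk leqNgt km => /(_ isT).
Qed.

Section Action.
Variables (d : measure_display) (X : measurableType d) (act : G -> X -> X).
Hypothesis fact : free_borel_action mul one act.

Lemma act_inj g h x : act g x = act h x -> g = h.
Proof.
have [mA m1 m2 mi im] := grp; have [a1 aM _ fr] := fact.
move=> e; have /fr e1 : act (mul (inv g) h) x = x by rewrite aM -e -aM mi a1.
by rewrite -[LHS]m2 -e1 mA im m1.
Qed.

Lemma actK g : cancel (act g) (act (inv g)).
Proof.
have [mA m1 m2 mi im] := grp; have [a1 aM _ fr] := fact.
by move=> x; rewrite -aM mi a1.
Qed.

Lemma actKV g : cancel (act (inv g)) (act g).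
Proof. by move=> x; rewrite -{1}(invgK g) actK. Qed.

Lemma iter_act g n x : iter n (act g) x = act (gpow mul one g n) x.
Proof.
have [a1 aM _ fr] := fact.
by elim: n => [|n IH]; rewrite /gpow /= ?a1// IH -aM.
Qed.

Lemma iter_act_inj g m n x : (m < n)%N -> iter m (act g) x = iter n (act g) x ->
  gpow mul one g (n - m) = one.
Proof.
have [_ _ _ fr] := fact.
move=> mn; rewrite -{1}(subnK (ltnW mn)) iterD !iter_act => e.
exact: (fr _ _ (esym e)).
Qed.

(** The product $g^n (g^{-1})^n$ telescopes. This is needed because orbits are followed backwards,
    by [inv s], while orders are those of [s]. *)
Lemma gpow_inv_eq1 g n : gpow mul one (inv g) n = one -> gpow mul one g n = one.
Proof.
have [mA m1 m2 mi im] := grp.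
suff h : mul (gpow mul one g n) (gpow mul one (inv g) n) = one.
  by move=> e; rewrite e m2 in h.
elim: n => [|n IH]; first by rewrite /gpow /= m1.
by rewrite -addn1 gpowD addnC gpowD {1 4}/gpow /= !m2 mA -(mA _ g) im m2 IH.
Qed.

Lemma measurable_preact g (Y : set X) :
  measurable Y -> measurable [set x | Y (act g x)].
Proof.
have [_ _ ma _] := fact; move=> mY.
by have := ma g measurableT _ mY; rewrite setTI.
Qed.

(* [k x] describes the edge (x, s x); [None] means that the edge is set aside and
   the alternation restarts after it. *)
Lemma interrupted_alternation (s : G) (T : set X) :
  measurable T ->
  (forall x, exists n, T (iter n (act (inv s)) x)) ->
  (forall x, T x -> ~ T (act s x)) ->
  exists k : X -> option bool,
    [/\ forall o, measurable [set x | k x = o],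
        forall x, k x = None -> T (act s x) &
        forall x, k x <> k (act s x)].
Proof.
have [_ _ ma _] := fact; move=> mT hT TN.
set par := hit_parity (act (inv s)) T.
exists (fun x => if `[< T (act s x) >] then None else Some (par x)); split.
- have mTs := measurable_preact s mT.
  move=> [b|].
    rewrite (_ : [set x | _] = ~` [set x | T (act s x)] `&` [set x | par x = b]).
      by apply: measurableI; [exact: measurableC|exact: measurable_hit_parity].
    rewrite eqEsubset; split=> x /=; case: asboolP => //.
    - by move=> nT [<-].
    - by move=> Ts [].
    - by move=> nT [_ <-].
  rewrite (_ : [set x | _] = [set x | T (act s x)]) //.
  by rewrite eqEsubset; split=> x /=; case: asboolP.
- by move=> x; case: asboolP.
(* An edge entering [T] is set aside, and [TN] keeps the next edge from being so. Otherwise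
   [act s x] is one step further from the last restart than [x], and the parity flips. *)
- move=> x; case: asboolP => [/TN Tx|Tx]; first by case: asboolP.
  case: asboolP => // _ [].
  have [n] := hT x; rewrite -{1}(actK s x) => h.
  rewrite [RHS](hit_parityN h Tx) actK -/par.
  by case: (par x).
Qed.

(** The alternation starts at the least point of each cycle and closes up because [n] is even: the
    edge returning to that point begins at odd distance $n-1$, the next one at distance $0$. *)
Lemma even_order_alternation (s : G) (n : nat) (A : nat -> set X) :
  (forall n, measurable (A n)) -> separating A ->
  has_order mul one s n -> ~~ odd n ->
  exists k : X -> option bool,
    [/\ forall o, measurable [set x | k x = o],
        forall x, k x <> None &
        forall x, k x <> k (act s x)].
Proof.
have [_ _ ma _] := fact; move=> mA sepA [n0 sn smin] en.
have [gA g1 g2 gi ig] := grp.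
set h := act (inv s).
have hn x : iter n h x = x.
  have [a1 _ _ _] := fact; rewrite /h iter_act -[RHS]a1; congr act.
  by apply: gpow_inv_eq1; rewrite invgK.
have hmod m x : iter m h x = iter (m %% n) h x.
  rewrite {1}(divn_eq m n) iterD.
  by elim: (m %/ n)%N (iter _ h x) => // q IH y; rewrite mulSn iterD IH hn.
have hinj x i j : (i < n)%N -> (j < n)%N -> iter i h x = iter j h x -> i = j.
  move=> + + e; wlog ij : i j e / (i < j)%N.
    move=> H hi hj; have [ij|ij|//] := ltngtP i j; first exact: H.
    by apply/esym/H.
  move=> hi hj; have /gpow_inv_eq1/smin := iter_act_inj ij e.
  by rewrite subn_gt0 ij (leq_ltn_trans (leq_subr _ _) hj) => /(_ isT isT).
pose T := \bigcap_(j in [set j | (0 < j < n)%N]) [set x | lex_lt A x (iter j h x)].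
have mT : measurable T.
  rewrite /T bigcap_mkcond; apply: bigcapT_measurable => j.
  case: ifP => // _; apply: measurable_lex_lt => //.
  exact: measurable_fun_iter (ma _).
have hT x : exists m, T (iter m h x).
  have [|i ilt imin] := @lex_lt_min X A (fun i => iter i h x) n.-1 sepA.
    by rewrite prednK// => i j; exact: hinj.
  (* Minimality concerns exponents below [n], so [j + i] is reduced modulo [n]; it is not congruent
     to [i] as $0<j<n$. *)
  rewrite prednK// in ilt imin; exists i => j /= /andP[j0 jn].
  rewrite /= -iterD (hmod (j + i)%N); apply: imin; first by rewrite ltn_mod.
  move=> e; have := eqn_modDr i j 0 n; rewrite add0n (modn_small jn) mod0n.
  by rewrite e (modn_small ilt) eqxx => /esym/eqP j00; rewrite j00 in j0.
(* Two points of [T] on one cycle would each precede the other. *)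
have Tuniq x j : T x -> (0 < j < n)%N -> ~ T (iter j h x).
  move=> Tx jn Tj; have /andP[j0 jn'] := jn.
  apply: (@lex_lt_irr _ A x); apply: lex_lt_trans (Tx _ jn) _.
  have := Tj (n - j)%N; rewrite /= -iterD subnK ?hn ?(ltnW jn')//; apply.
  by rewrite subn_gt0 jn' ltn_subrL n0 j0.
set par := hit_parity h T.
exists (fun x => Some (par x)); split => //.
  move=> [b|]; last first.
    by rewrite (_ : [set x | _] = set0)// eqEsubset; split.
  rewrite (_ : [set x | _] = [set x | par x = b]); first exact: (measurable_hit_parity b (ma _) mT).
  by rewrite eqEsubset; split=> x /= => [[]|->].
move=> x []; case: (pselect (T (act s x))) => Tx.
  have h0 : first_hit h T 0 (act s x) by split.
  have h1 : first_hit h T n.-1 x.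
    rewrite -[x in first_hit _ _ _ x](actK s) -/h; split.
      by rewrite -iterSr prednK// hn.
    move=> m mn; rewrite -iterSr; apply: Tuniq => //.
    by rewrite /= -(prednK n0) ltnS.
  rewrite /par (hit_parityE h0) (hit_parityE h1) /=.
  by move: en; rewrite -{1}(prednK n0) /= negbK => ->.
have [m] := hT x; rewrite -{1}(actK s x) => hm.
rewrite /par (hit_parityN hm Tx) /h actK -/h -/par.
by case: (par x).
Qed.

(** * Balls around a set in the Schreier graph *)

Section Balls.
Variable S : seq G.
Hypothesis S1 : one \notin S.
Hypothesis Sinv : forall s, s \in S -> inv s \in S.

Lemma schreier_act s x : s \in S -> schreier_graph act S x (act s x).
Proof.
have [_ _ _ fr] := fact; move=> sS; split; last by exists s.
by move=> /esym/fr s1; move: S1; rewrite -s1 sS.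
Qed.

Lemma schreier_sym x y : schreier_graph act S x y -> schreier_graph act S y x.
Proof.
by move=> [_ [s sS <-]]; rewrite -{2}(actK s x); apply: schreier_act; exact: Sinv.
Qed.

Lemma walk_cat (E : X -> X -> Prop) m n x y z :
  walk E m x y -> walk E n y z -> walk E (m + n) x z.
Proof.
elim: m x => [|m IH] x /=; first by move=> ->.
by move=> [w [xw wy]] yz; exists w; split => //; exact: IH.
Qed.

Lemma walk_sym (E : X -> X -> Prop) n x y :
  (forall x y, E x y -> E y x) -> walk E n x y -> walk E n y x.
Proof.
move=> Es; elim: n x => [|n IH] x /=; first by [].
move=> [w [xw /IH wy]]; suff: walk E (n + 1) y x by rewrite addn1.
apply: walk_cat wy _.
by exists x; split => //; exact: Es.
Qed.

Lemma finite_walk n x : finite_set [set y | walk (schreier_graph act S) n x y].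
Proof.
elim: n x => [|n IH] x /=.
  rewrite (_ : [set y | _] = [set x]); first exact: finite_set1.
  by rewrite eqEsubset; split=> y /= ->.
apply: (@sub_finite_set _ _ (\bigcup_(s in [set` S])
   [set y | walk (schreier_graph act S) n (act s x) y])).
  by move=> y /= [w [[_ [s sS <-]] wy]]; exists s.
by apply: bigcup_finite => // s _; exact: IH.
Qed.

(** Recursion through finitely many preimages, rather than existence of a walk, makes measurability
    an immediate induction. *)
Fixpoint act_ball (U : set X) (r : nat) : set X :=
  if r is r'.+1 then
    act_ball U r' `|` \bigcup_(s in [set` S]) [set x | act_ball U r' (act s x)]
  else U.

Lemma measurable_act_ball U r : measurable U -> measurable (act_ball U r).
Proof.
move=> mU; elim: r => //= r IH; apply: measurableU => //.
by apply: fin_bigcup_measurable => // s _; exact: measurable_preact.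
Qed.

Lemma act_ball_le U m n x : (m <= n)%N -> act_ball U m x -> act_ball U n x.
Proof.
move=> /subnK <-; elim: (n - m)%N => //= k IH /IH; by left.
Qed.

Lemma act_ball_step U r s x : s \in S -> act_ball U r (act s x) -> act_ball U r.+1 x.
Proof. by move=> sS h; right; exists s. Qed.

Lemma act_ball_walk U r x : act_ball U r x ->
  exists z n, [/\ U z, (n <= r)%N & walk (schreier_graph act S) n x z].
Proof.
elim: r x => [|r IH] x /=; first by move=> Ux; exists x, 0%N.
case=> [/IH[z [n [Uz nr w]]]|[s /= sS /IH[z [n [Uz nr w]]]]].
  by exists z, n; split => //; exact: leq_trans nr _.
by exists z, n.+1; split => //; exists (act s x); split => //; exact: schreier_act.
Qed.

(** Choose [z n] in [U] within distance [r] of [y n]. Consecutive choices are at most $2r+1$ apart,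
    so all lie in one finite component; the injective ray would then stay within [r] of a finite
    set. *)
Lemma no_ray_in_ball (U : set X) (N r : nat) (y : nat -> X) :
  (forall x, U x ->
     finite_set (induced_component (graph_pow_le (schreier_graph act S) N) U x)) ->
  (r.*2.+1 <= N)%N ->
  injective y -> (forall n, schreier_graph act S (y n) (y n.+1)) ->
  ~ forall n, act_ball U r (y n).
Proof.
set E := schreier_graph act S => Ufin rN yinj yE yB.
have /choice[z zP] : forall n, exists z, U z /\ exists2 k, (k <= r)%N & walk E k (y n) z.
  move=> n; have [z [k [Uz kr w]]] := act_ball_walk (yB n).
  by exists z; split => //; exists k.
set F := induced_component (graph_pow_le E N) U (z 0%N).
have Fz n : F (z n).
  elim: n => [|n IH]; first exact: rt_refl.
  case: (pselect (z n = z n.+1)) => [<-//|zn].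
  apply: rt_trans IH _; apply: rt_step.
  have [Un [k kr wk]] := zP n; have [Um [l lr wl]] := zP n.+1.
  split => //; split => //; split => //.
  exists (k + (1 + l))%N; split.
    apply: leq_trans rN; rewrite addnCA add1n ltnS -addnn.
    exact: leq_add.
  apply: walk_cat (walk_sym schreier_sym wk) _.
  by apply: walk_cat wl; exists (y n.+1).
have fin : finite_set (\bigcup_(w in F) \bigcup_(k in `I_r.+1) [set v | walk E k w v]).
  apply: bigcup_finite => [|w _]; first by apply: Ufin; case: (zP 0%N).
  by apply: bigcup_finite => [|k _]; [exact: finite_II|exact: finite_walk].
apply: infinite_nat; apply: sub_finite_set (finite_preimage _ fin).
  move=> n _; have [_ [k kr w]] := zP n.
  by exists (z n) => //; exists k => //; exact: walk_sym schreier_sym w.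
by move=> a b _ _; exact: yinj.
Qed.

Lemma infinite_order_alternation (s : G) (U0 U1 : set X) (N r : nat) :
  measurable U0 ->
  (forall x, U0 x \/ U1 x) ->
  (forall x, U0 x ->
     finite_set (induced_component (graph_pow_le (schreier_graph act S) N) U0 x)) ->
  (forall x, U1 x ->
     finite_set (induced_component (graph_pow_le (schreier_graph act S) N) U1 x)) ->
  (r.*2.+1 <= N)%N -> s \in S ->
  ~ (exists n, has_order mul one s n) ->
  exists k : X -> option bool,
    [/\ forall o, measurable [set x | k x = o],
        forall x, k x = None -> act_ball U0 r x /\ ~ act_ball U0 r (act s x) &
        forall x, k x <> k (act s x)].
Proof.
move=> mU U01 fin0 fin1 rN sS sinf.
set h := act (inv s).
have hinj x : injective (fun n => iter n h x).
  move=> i j; wlog ij : i j / (i < j)%N.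
    move=> H e; have [ij|ij|//] := ltngtP i j; first exact: H.
    by apply/esym/H.
  move=> e; have /gpow_inv_eq1 := iter_act_inj ij e.
  move=> /has_order_ex; rewrite subn_gt0 => /(_ ij) o.
  by case: sinf.
have hE x n : schreier_graph act S (iter n h x) (iter n.+1 h x).
  by rewrite iterS; apply: schreier_act; exact: Sinv.
pose B := act_ball U0 r.
have mB : measurable B by exact: measurable_act_ball.
(* The points where the line has just left the ball: an edge into [T] goes from inside to outside,
   so two consecutive edges never both enter [T]. *)
pose T := [set x | B (h x)] `&` ~` B.
have [||x [_ TB]|k [k1 k2 k3]] := @interrupted_alternation s T.
- apply: measurableI; [exact: measurable_preact|exact: measurableC].
- move=> x; apply: contrapT => /forallNP nT.
  have /existsNP[n nB] := no_ray_in_ball fin0 rN (hinj x) (hE x).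
  (* Once outside the ball, the backward half-line stays outside: a step back into it would start at
     a point of [T]. *)
  have nBm m : ~ B (iter m h (iter n h x)).
    elim: m => [//|m IH] Bm; apply: (nT (m + n)%N).
    by split; rewrite ?iterD.
  have N0 : (0.*2.+1 <= N)%N by exact: leq_trans rN.
  apply: (no_ray_in_ball fin1 N0 (hinj (iter n h x)) (hE _)) => m.
  case: (U01 (iter m h (iter n h x))) => // Um.
  by case: (nBm m); exact: (@act_ball_le _ 0).
- by rewrite /T /= /h actK => -[].
- exists k; split => // x /k2[]; rewrite /= /h actK.
  by [].
Qed.

End Balls.
End Action.
End GroupAction.

(** * Assembling the coloring from the generators *)

Theorem theorem1 (Gam : eqType) (mul : Gam -> Gam -> Gam) (one : Gam) (inv : Gam -> Gam)
    (S : seq Gam) (d : measure_display) (X : measurableType d) (act : Gam -> X -> X) :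
  marked_group mul one inv S ->
  standard_borel X ->
  free_borel_action mul one act ->
  asiB_eq (schreier_graph act S) 1 ->
  (forall s, s \in S -> forall n, has_order mul one s n -> ~~ odd n) ->
  exists c : X * X -> 'I_(size S).+1,
    borel_edge_coloring (schreier_graph act S) c.
Proof.
move=> [grp _ S1 Sinv _] /standard_borel_separating[A [mA sepA]] fact [asi _] even_order.
have [_ _ ma _] := fact.
have iK := invgK grp.
(* The radii used are at most $2|S|$, and [no_ray_in_ball] asks for $2r+1\le N$. *)
have [U [mU Ucover _ Ufin]] := asi (size S).*2.*2.+1 isT.
have U01 x : U ord0 x \/ U ord_max x.
  have [i Ui] := Ucover x; have [i0|i1] := eqVneq i ord0; first by left; rewrite -i0.
  right; suff <- : i = ord_max by [].
  by apply: val_inj; case: i i1 {Ui} => -[|[|]].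
pose B := act_ball act S (U ord0).
(* One specification covers both kinds of generators: for even order [None] never occurs. Doubling
   the index leaves room for both ends of a set-aside edge. *)
have /choice[k kP] : forall s, exists k : X -> option bool, s \in S ->
    [/\ forall o, measurable [set x | k x = o],
        forall x, k x = None -> B (index s S).*2 x /\ ~ B (index s S).*2 (act s x) &
        forall x, k x <> k (act s x)].
  move=> s; have [sS|sS] := boolP (s \in S); last by exists (fun=> None).
  case: (pselect (exists n, has_order mul one s n)) => [[n sn]|sinf].
    have [k [k1 k2 k3]] := even_order_alternation grp fact mA sepA sn (even_order s sS n sn).
    by exists k => _; split=> // x /k2.
  have [|k kP] := infinite_order_alternation grp fact S1 Sinv (r := (index s S).*2)
    (mU ord0) U01 (Ufin ord0) (Ufin ord_max) _ sS sinf; last by exists k.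
  by rewrite ltnS leq_double leq_double index_size.
pose ix s : 'I_(size S).+1 := inord (index s S).
have ixE s : ix s = index s S :> nat by rewrite inordK// ltnS index_size.
have ix_inj s t : s \in S -> t \in S -> ix s = ix t -> s = t.
  move=> sS tS /(congr1 val) /=; rewrite !ixE => e.
  by rewrite -(nth_index one sS) e nth_index.
have ix_max s : s \in S -> ix s <> ord_max.
  move=> sS /(congr1 val) /=; rewrite ixE => e.
  by move: sS; rewrite -index_mem e ltnn.
pose val s x : 'I_(size S).+1 :=
  if inv s == s then ix s else
  match k s x with Some b => ix (if b then s else inv s) | None => ord_max end.
(* [k s] and [k (inv s)] are chosen independently, so each pair of inverse generators is colored
   through one member only, that of smaller index. *)
pose pos s := (index s S <= index (inv s) S)%N.
pose col s x := if pos s then val s x else val (inv s) (act s x).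
have pos_inv s : s \in S -> inv s != s -> pos (inv s) = ~~ pos s.
  move=> sS sN; rewrite /pos iK -ltnNge ltn_neqAle; case: eqP => //= e.
  case/eqP: sN; rewrite -(nth_index one (Sinv _ sS)) e.
  by rewrite nth_index.
have col_sym s x : s \in S -> col (inv s) (act s x) = col s x.
  move=> sS; rewrite /col; have [ss|sN] := eqVneq (inv s) s.
    by rewrite /pos !ss leqnn /val ss eqxx.
  rewrite pos_inv//; case: (pos s) => //=.
  by rewrite iK (actK grp fact).
have val_step s x : s \in S -> inv s != s -> val s x <> val s (act s x).
  move=> sS sN; rewrite /val (negbTE sN); have [_ _ kN] := kP s sS.
  have := kN x; case: (k s x) => [b|]; case: (k s (act s x)) => [b'|] //.
  - have ixN : ix s <> ix (inv s).
      by move=> /(ix_inj _ _ sS (Sinv _ sS)) e; case/eqP: sN.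
    by case: b; case: b' => // _ /esym.
  - by move=> _; apply: ix_max; case: ifP => // _; exact: Sinv.
  - by move=> _ /esym; apply: ix_max; case: ifP => // _; exact: Sinv.
(* The two edges at [x] on one line are consecutive for whichever of [s], [inv s] does the
   coloring. *)
have col_step s x : s \in S -> inv s != s -> col s x <> col (inv s) x.
  move=> sS sN; rewrite /col pos_inv//; case: (pos s) => /= e.
    apply: (val_step s (act (inv s) x) sS sN).
    by rewrite (actKV grp fact) e iK.
  have sN' : inv (inv s) != inv s by rewrite iK eq_sym.
  apply: (val_step (inv s) (act s x) (Sinv _ sS) sN').
  by rewrite (actK grp fact).
(* The last case is an edge set aside by p: both its ends lie at distance 2i
   or 2i+1 from U_0, where i is the index of p. *)
have colP s x : s \in S -> exists p, [/\ p \in S, p = s \/ p = inv s &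
    (exists2 q, q = p \/ q = inv p & q \in S /\ col s x = ix q) \/
    [/\ col s x = ord_max, B (index p S).*2.+1 x &
      forall r, (r < (index p S).*2)%N -> ~ B r x]].
  move=> sS.
  have valP p y : p \in S ->
    (exists2 q, q = p \/ q = inv p & q \in S /\ val p y = ix q) \/
    [/\ val p y = ord_max, B (index p S).*2 y & ~ B (index p S).*2 (act p y)].
    move=> pS; rewrite /val; case: ifP => [_|_]; first by left; exists p; [left|].
    have [_ kN _] := kP p pS; have := kN y.
    case: (k p y) => [b _|/(_ erefl)[h1 h2]]; last by right.
    by left; case: b; [exists p; [left|]|exists (inv p); [right|split=> //; exact: Sinv]].
  have ball_stepN p y r : p \in S -> (r < (index p S).*2)%N ->
      ~ B (index p S).*2 (act p y) -> ~ B r y.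
    move=> pS rp nB Br; apply: nB; apply: (@act_ball_le _ _ _ _ _ _ r.+1) => //.
    by apply: (@act_ball_step _ _ _ _ _ _ _ (inv p)); rewrite ?Sinv// (actK grp fact).
  (* If [pos s] holds, [x] is the inner end of a set-aside edge; otherwise it is the outer end, the
     edge being traversed from [act s x] by [inv s]. *)
  rewrite /col; case: (boolP (pos s)) => _.
    exists s; split => //; [by left|].
    case: (valP s x sS) => [?|[h1 h2 h3]]; [by left|right; split => //].
      exact: act_ball_le h2.
    by move=> r rs; exact: ball_stepN h3.
  have iS := Sinv _ sS.
  exists (inv s); split => //; [by right|].
  case: (valP (inv s) (act s x) iS) => [?|[h1 h2 h3]]; [by left|right].
  rewrite (actK grp fact) in h3; split => //.
    exact: act_ball_step sS h2.
  by move=> r rs Br; apply: h3; exact: act_ball_le (ltnW rs) Br.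
have col_proper s t x : s \in S -> t \in S -> s <> t -> col s x <> col t x.
  move=> sS tS st.
  have [ts|ts] := eqVneq t (inv s).
    by rewrite ts; apply: col_step => //; rewrite -ts; apply/eqP => /esym.
  have [p [pS ps cp]] := colP s x sS; have [q [qS qt cq]] := colP t x tS.
  (* The two edges now belong to different pairs of inverse generators, whose ordinary colors are
     disjoint. *)
  have pq : p <> q /\ p <> inv q.
    have st' : s <> inv t by move=> e; case/eqP: ts; rewrite e iK.
    have st'' : inv s <> inv t by move=> /(congr1 inv); rewrite !iK.
    have ts' : inv s <> t by move=> e; case/eqP: ts.
    by case: ps => ->; case: qt => ->; rewrite ?iK.
  case: cp => [[u up [uS ->]]|[-> px pN]].
    case: cq => [[v vq [vS ->]]|[-> _ _]]; last exact: ix_max.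
    move=> /ix_inj-/(_ uS vS) uv; case: pq.
    have : p = u \/ p = inv u by case: up => ->; rewrite ?iK; [left|right].
    by rewrite uv; case=> ->; case: vq => ->; rewrite ?iK; tauto.
  case: cq => [[v vq [vS ->]]|[-> qx qN]]; first by move=> /esym; exact: ix_max.
  (* For indices $i<j$ one has $2i+1<2j$, so the shells are disjoint. *)
  have far a b y : (index a S < index b S)%N -> B (index a S).*2.+1 y ->
      ~ forall r, (r < (index b S).*2)%N -> ~ B r y.
    by move=> ab ya; move=> /(_ (index a S).*2.+1); apply=> //; rewrite -doubleS leq_double.
  case: (ltngtP (index p S) (index q S)) => [pq'|qp'|e] _.
  - exact: far pq' px qN.
  - exact: far qp' qx pN.
  - by case: pq => + _; apply; rewrite -(nth_index one pS) e nth_index.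
have mval s i : s \in S -> measurable [set x | val s x = i].
  move=> sS; have [mk _ _] := kP s sS; rewrite /val.
  case: eqP => _.
    have [->|/eqP si] := eqVneq (ix s) i.
      by rewrite (_ : [set _ | _] = setT)// eqEsubset; split.
    by rewrite (_ : [set _ | _] = set0)// eqEsubset; split.
  (* The union is finite because [option bool] is. *)
  rewrite (_ : [set x | _] = \bigcup_(o in [set o | match o with
      Some b => ix (if b then s else inv s) | None => ord_max end = i])
        [set x | k s x = o]).
    by apply: fin_bigcup_measurable => // o _; exact: mk.
  rewrite eqEsubset; split=> x /=; first by exists (k s x).
  by move=> [ob obi /= ->].
have mcol s i : s \in S -> measurable [set x | col s x = i].
  move=> sS; rewrite /col; case: (pos s); first exact: mval.
  exact: (measurable_preact fact s (mval _ i (Sinv _ sS))).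
(* By freeness at most one generator sends [p.1] to [p.2]. For pairs joined by none the condition is
   vacuous and [ord_max] is an arbitrary witness. *)
have /choice[c cP] : forall p : X * X, exists i, forall s, s \in S ->
    act s p.1 = p.2 -> col s p.1 = i.
  move=> p; case: (pselect (exists2 s, s \in S & act s p.1 = p.2)) => [[s sS sp]|ns].
    by exists (col s p.1) => t tS; rewrite -sp => /(act_inj grp fact) ->.
  by exists ord_max => s sS sp; case: ns; exists s.
exists c; split.
- move=> x y [_ [s sS sx]].
  rewrite -(cP (x, y) s sS sx) -(cP (y, x) (inv s) (Sinv _ sS)) /=.
    by rewrite -sx col_sym.
  by rewrite -sx (actK grp fact).
- move=> x y z [_ [s sS sx]] [_ [t tS tx]] yz.
  rewrite -(cP (x, y) s sS sx) -(cP (x, z) t tS tx) /=.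
  by apply: col_proper => // st; apply: yz; rewrite -sx -tx st.
- move=> i.
  (* A color class is a finite union of Borel graphs of generators, each cut down by a Borel
     condition on the first coordinate. *)
  rewrite (_ : [set p | _] = \bigcup_(s in [set` S])
     ([set p : X * X | act s p.1 = p.2] `&` [set p : X * X | col s p.1 = i])).
    apply: fin_bigcup_measurable => // s sS; apply: measurableI.
      apply: (measurable_eq_fun mA sepA); last exact: measurable_snd.
      exact: measurableT_comp (ma s) measurable_fst.
    rewrite -[X in measurable X]setTI.
    exact: (measurable_fst measurableT _ (mcol s i sS)).
  rewrite eqEsubset; split=> -[x y] /=.
    by move=> [[_ [s sS sx]] ci]; exists s => //; split => //; rewrite -ci /= (cP (x, y)).
  move=> [s /= sS [sx si]]; split; first by rewrite -sx; exact: (schreier_act fact S1).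
  by rewrite -(cP (x, y) s sS sx).
Qed.
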